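(* For every integer $n\ge1$, the cubature formula $$2\int_\Delta f(t_1,t_2)\,dt_1dt_2=\frac1{3n^2}\sum_{j_1=0}^n\sum_{j_2=0}^{n-j_1}\lambda_{\mathbf j}^{(n)}f\Big(\frac{j_1}{n},\frac{j_2}{n}\Big),\qquad \mathbf j=(j_1,j_2,-j_1-j_2),$$ is exact (holds with equality) for all $f\in\mathcal{TC}_{2n-1}$.
   Context: $\mathbb R^3_H=\{\mathbf t\in\mathbb R^3:t_1+t_2+t_3=0\}$, $\mathbb H=\mathbb Z^3\cap\mathbb R^3_H$, $\phi_{\mathbf k}(\mathbf t)=e^{\frac{2\pi i}{3}\mathbf k\cdot\mathbf t}$ for $\mathbf k\in\mathbb H$, and $$\mathsf{TC}_{\mathbf k}=\tfrac16\big[\phi_{k_1,k_2,k_3}+\phi_{k_2,k_3,k_1}+\phi_{k_3,k_1,k_2}+\phi_{-k_1,-k_3,-k_2}+\phi_{-k_2,-k_1,-k_3}+\phi_{-k_3,-k_2,-k_1}\big].$$ $\Delta=\{(t_1,t_2):t_1,t_2\ge0,\ t_1+t_2\le1\}$; a function of $\mathbf t\in\mathbb R_H^3$ is regarded as a function of $(t_1,t_2)$ via $t_3=-t_1-t_2$. $\Lambda_n=\{\mathbf k\in\mathbb H:k_1\ge0,k_2\ge0,-k_3\le n\}$ and $\mathcal{TC}_m=\mathrm{span}_{\mathbb C}\{\mathsf{TC}_{\mathbf k}:\mathbf k\in\Lambda_m\}$. The weights, for $\mathbf j\in\Lambda_n$, are: $\lambda_{\mathbf j}^{(n)}=6$ if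 $j_1>0,j_2>0,-j_3<n$; $\lambda_{\mathbf j}^{(n)}=1$ if $\mathbf j\in\{(n,0,-n),(0,n,-n),(0,0,0)\}$; $\lambda_{\mathbf j}^{(n)}=3$ for all other $\mathbf j\in\Lambda_n$. *)

(* Defs.v *)
From HB Require Import structures.
From mathcomp Require Import all_boot all_order all_algebra.
From mathcomp Require Import all_classical all_reals all_analysis.
From mathcomp Require Import complex.

Set Implicit Arguments.
Unset Strict Implicit.
Unset Printing Implicit Defensive.
Import Order.TTheory GRing.Theory Num.Theory.
Import numFieldNormedType.Exports.

Local Open Scope classical_set_scope.
Local Open Scope complex_scope.
Local Open Scope ring_scope.

Definition vec3 (V : Type) (a b c : V) : 'rV[V]_3 :=
  \row_(i < 3) tnth [tuple a; b; c] i.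

(* The plane t_1 + t_2 + t_3 = 0: R^3_H for V a real field, H for V := int.
   Coordinates are numbered from 0, so t_1, t_2, t_3 are t 0 0, t 0 1, t 0 2. *)
Definition planeH (V : zmodType) : {pred 'rV[V]_3} :=
  [pred t : 'rV[V]_3 | t 0 0 + t 0 1 + t 0 2 == 0].

Definition cexp (R : realType) (z : R[i]) : R[i] :=
  (expR (complex.Re z))%:C * (cos (complex.Im z) +i* sin (complex.Im z)).

Definition dotH (R : realType) (k : 'rV[int]_3) (t : 'rV[R]_3) : R :=
  \sum_(i < 3) (k 0 i)%:~R * t 0 i.

Definition phi (R : realType) (k : 'rV[int]_3) (t : 'rV[R]_3) : R[i] :=
  cexp ((2 * pi)%:C * 'i%C / 3 * (dotH k t)%:C).

Definition TC (R : realType) (k : 'rV[int]_3) (t : 'rV[R]_3) : R[i] :=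
  let k1 := k 0 0 in let k2 := k 0 1 in let k3 := k 0 2 in
  6^-1 * (phi (vec3 k1 k2 k3) t + phi (vec3 k2 k3 k1) t
        + phi (vec3 k3 k1 k2) t + phi (vec3 (- k1) (- k3) (- k2)) t
        + phi (vec3 (- k2) (- k1) (- k3)) t
        + phi (vec3 (- k3) (- k2) (- k1)) t).

Definition Lambda (n : nat) : {pred 'rV[int]_3} :=
  [pred k : 'rV[int]_3 | [&& k \in @planeH int,
     0 <= k 0 0, 0 <= k 0 1 & - k 0 2 <= n%:Z]].

(* Complex span of the TC_k, k in Lambda_m, as functions on R^3_H; values off
   the plane are irrelevant. *)
Definition TCspan (R : realType) (m : nat) : set ('rV[R]_3 -> R[i]) :=
  [set f | exists (s : seq 'rV[int]_3) (c : 'rV[int]_3 -> R[i]),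
     {subset s <= Lambda m} /\
     {in @planeH R, forall t, f t = \sum_(k <- s) c k * TC k t}].

Definition lambda (n : nat) (j : 'rV[int]_3) : nat :=
  if [&& 0 < j 0 0, 0 < j 0 1 & - j 0 2 < n%:Z] then 6
  else if j \in [:: vec3 n%:Z 0 (- n%:Z); vec3 0 n%:Z (- n%:Z); vec3 0 0 0]
  then 1 else 3.

Definition Delta (R : realType) : set (R * R) :=
  [set x | [/\ 0 <= x.1, 0 <= x.2 & x.1 + x.2 <= 1]].

Definition in_coords (R : realType) (f : 'rV[R]_3 -> R[i]) (t1 t2 : R) : R[i] :=
  f (vec3 t1 t2 (- t1 - t2)).

Definition cintegral d (T : measurableType d) (R : realType)
    (mu : {measure set T -> \bar R}) (D : set T) (g : T -> R[i]) : R[i] :=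
  Rintegral mu D (fun x => complex.Re (g x))
    +i* Rintegral mu D (fun x => complex.Im (g x)).

(* Main.v *)
Require Import Defs.
From mathcomp Require Import all_boot all_order all_algebra.
From mathcomp Require Import all_classical all_reals all_analysis.
From mathcomp Require Import measurable_realfun complex ring lra zify.

Set Implicit Arguments.
Unset Strict Implicit.
Unset Printing Implicit Defensive.
Import Order.TTheory GRing.Theory Num.Theory.
Import numFieldNormedType.Exports.
Local Open Scope classical_set_scope.
Local Open Scope complex_scope.
Local Open Scope ring_scope.

(** Both sides are linear in f, so it suffices to treat f = TC_k. They both
    vanish unless k = 0, and both equal 1 for k = 0. With a = k_1 - k_3 and
    b = k_2 - k_3, TC_k is the average over six frequencies (p, q), the orbit
    of (a, b), of the plane waves exp (2 pi i (p x + q y) / 3).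

    Why the integral vanishes: TC_k is an eigenfunction of the Laplacian of the
    regular triangular lattice, with eigenvalue proportional to
    Q = a^2 - a b + b^2, and it is even under the reflections in the sides of
    the triangle, so its normal derivative is zero on the boundary. Green's
    formula then says that Q times the integral is 0, and Q <> 0 for k <> 0.
    In coordinates, two applications of Fubini express 2 Q times the integral
    of one wave through three integrals along the sides
    ([intDelta_cos_green]), and these cancel in the sum over the orbit
    ([intDelta_cos_orbit6]).

    Why the cubature sum vanishes: the same argument for the difference
    Laplacian that compares a lattice point with its six neighbours. The weights
    6, 3, 1 are proportional to the angle that the triangle occupies at the node,
    which is the choice for which reflection symmetry kills the boundary terms of
    the discrete Green formula. With X and Y the values of a wave on the two
    lattice steps, the formula for one wave is [laplacian_weighted_sum]: the edge
    terms pair up along the orbit ([edge_defect_pair]) and telescope to the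
    corners, where they cancel the corner terms ([laplacian_orbit_sum]).
    The eigenvalue is
    2 cos s + 2 cos t + 2 cos (s - t) - 6 with s = 2 pi a / (3 n) and
    t = 2 pi b / (3 n). It could vanish only if a and b were both multiples of
    3 n. For k <> 0 in Lambda_(2 n - 1), a and b are positive and
    a + b <= 3 (2 n - 1) < 6 n, so one of them lies strictly between 0 and 3 n:
    this is where the degree 2 n - 1 comes from. *)

(** * Integration over the triangle *)

Section DeltaIntegral.
Variable R : realType.
Let mu := @lebesgue_measure R.
Let mu2 := (mu \x mu)%E.

(** The ascription selects the measurable structure of R on which Lebesgue
    measure is defined; inference would choose another one, with the same sets
    but a different display. *)
Lemma measurable_Delta :
  measurable (@Delta R : set (measurableTypeR R * measurableTypeR R)).
Proof.
have -> : @Delta R = [set x : R * R | 0 <= x.1] `&` [set x | 0 <= x.2]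
   `&` [set x | x.1 + x.2 <= 1].
  by apply/seteqP; split => [x [] //|x [] []].
have m1 : measurable_fun [set: R * R] (fst : R * R -> R) by exact: measurable_fst.
have m2 : measurable_fun [set: R * R] (snd : R * R -> R) by exact: measurable_snd.
have H (f : R * R -> R) : measurable_fun setT f -> measurable [set x | 0 <= f x].
  move=> mf; rewrite (_ : [set x | _] = setT `&` f @^-1` `[0, +oo[).
    exact: mf.
  by apply/seteqP; split => x /=; rewrite in_itv/= andbT; tauto.
apply: measurableI; first by apply: measurableI; apply: H.
rewrite (_ : [set x | _] = [set x : R * R | 0 <= 1 - (x.1 + x.2)]).
  by apply: H; apply: measurable_funB => //; exact: measurable_funD.
by apply/seteqP; split => x /=; rewrite subr_ge0.
Qed.

Lemma mu2_Delta_fin : (mu2 (@Delta R) < +oo)%E.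
Proof.
apply: (@le_lt_trans _ _ (mu2 (`[0, 1] `*` `[0, 1]))).
  apply: le_measure; rewrite ?inE; first exact: measurable_Delta.
    exact: measurableX.
  move=> [x y] [/= x0 y0 xy].
  by split; rewrite /= in_itv/=; apply/andP; split => //; lra.
set I := `[0, 1]%classic.
have -> : mu2 (I `*` I) = (mu I * mu I)%E.
  by apply: product_measure1E; exact: measurable_itv.
by rewrite /I /mu lebesgue_measure_itv/= lte_fin ltr01 oppr0 adde0 mule1 ltry.
Qed.

Lemma mu_segment_fin (a b : R) : (mu `[a, b] < +oo)%E.
Proof. by rewrite /mu lebesgue_measure_itv/=; case: ifP => _; rewrite ?ltry. Qed.

Lemma in_Delta (x y : R) :
  ((x, y) \in @Delta R) = (x \in `[0, 1]) && (y \in `[0, 1 - x]).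
Proof.
rewrite !in_itv/=; apply/idP/idP; rewrite inE.
  by move=> [/= x0 y0 xy]; apply/andP; split; apply/andP; split => //; lra.
by move=> /andP[/andP[x0 x1] /andP[y0 y1]]; split => //=; lra.
Qed.

Lemma in_DeltaC (x y : R) : ((x, y) \in @Delta R) = ((y, x) \in @Delta R).
Proof. by apply/idP/idP; rewrite !inE => -[/= ? ? ?]; split; rewrite //= addrC. Qed.

Lemma integrable_Delta (g : R * R -> R) (M : R) :
  measurable_fun setT g -> (forall z, `|g z| <= M) ->
  mu2.-integrable (@Delta R) (EFin \o g).
Proof.
move=> mg bg; apply: measurable_bounded_integrable.
- exact: measurable_Delta.
- exact: mu2_Delta_fin.
- exact: measurable_funS mg.
- exists M; split; rewrite ?num_real // => x Mx z _.
  by apply: (le_trans (bg z)); exact: ltW.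
Qed.

(** Common to both orders of integration; the second one is obtained from the
    symmetry of the triangle under exchange of coordinates. *)
Lemma iterated_Delta (g : R * R -> R) (M : R) :
  measurable_fun setT g -> (forall z, `|g z| <= M) ->
  fine (\int[mu]_x \int[mu]_y ((EFin \o g) \_ (@Delta R)) (x, y)) =
  \int[mu]_(x in `[0, 1]) (\int[mu]_(y in `[0, 1 - x]) g (x, y)).
Proof.
move=> mg bg; congr fine; rewrite [RHS]integral_mkcond.
apply: eq_integral => x _ /=.
have slice y : ((EFin \o g) \_ (@Delta R)) (x, y) =
    if x \in `[0, 1]%classic then ((fun y => (g (x, y))%:E) \_ `[0, 1 - x]) y else 0%E.
  by rewrite !patchE in_Delta !mem_setE; case: (x \in `[0, 1]).
rewrite patchE; under eq_integral do rewrite slice.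
case: ifPn => x01; last by rewrite integral0.
rewrite fineK; first by rewrite [RHS]integral_mkcond.
apply: integrable_fin_num => //; apply: measurable_bounded_integrable => //.
- exact: mu_segment_fin.
- apply: measurable_funS (measurableT_comp mg (measurable_pair1 x)) => //.
- exists M; split; rewrite ?num_real // => r Mr z _.
  by apply: (le_trans (bg _)); exact: ltW.
Qed.

Lemma Rintegral_Delta12 (g : R * R -> R) (M : R) :
  measurable_fun setT g -> (forall z, `|g z| <= M) ->
  Rintegral mu2 (@Delta R) g =
  \int[mu]_(x in `[0, 1]) (\int[mu]_(y in `[0, 1 - x]) g (x, y)).
Proof.
move=> mg bg; rewrite -(iterated_Delta mg bg) /Rintegral integral_mkcond.
rewrite -integral12_prod_meas1//; apply/integrable_restrict => //.
  exact: measurable_Delta.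
by rewrite setTI; exact: integrable_Delta bg.
Qed.

Lemma Rintegral_Delta21 (g : R * R -> R) (M : R) :
  measurable_fun setT g -> (forall z, `|g z| <= M) ->
  Rintegral mu2 (@Delta R) g =
  \int[mu]_(y in `[0, 1]) (\int[mu]_(x in `[0, 1 - y]) g (x, y)).
Proof.
move=> mg bg.
have mgs : measurable_fun setT (g \o unstable.swap).
  exact: (measurableT_comp mg (@measurable_swap _ _ _ _)).
rewrite -(iterated_Delta mgs (fun z => bg _)) /Rintegral integral_mkcond.
have ig : mu2.-integrable setT ((EFin \o g) \_ (@Delta R)).
  apply/integrable_restrict => //; first exact: measurable_Delta.
  by rewrite setTI; exact: integrable_Delta bg.
rewrite -(integral21_prod_meas1 ig); congr fine.
apply: eq_integral => y _; apply: eq_integral => x _.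
rewrite !patchE in_DeltaC; case: ifP => _; reflexivity.
Qed.

Lemma continuous_affine (c d : R) : continuous (fun x : R => c * x + d).
Proof.
move=> x; apply: cvgD; last exact: cvg_cst.
by apply: cvgM; [exact: cvg_cst|exact: cvg_id].
Qed.

(** Keeping the factor c on the left lets the formula hold for c = 0 as well,
    so that no frequency has to be treated apart. *)
Lemma Rintegral_affine_FTC (F f : R -> R) (c d u : R) : 0 <= u ->
  (forall x : R, is_derive x 1 F (f x)) -> continuous f ->
  c * \int[mu]_(x in `[0, u]) f (c * x + d) = F (c * u + d) - F d.
Proof.
move=> u0 dF cf.
have cfa : continuous (fun x => f (c * x + d)).
  move=> x; apply: (@continuous_comp _ _ _ (fun x => c * x + d) f).
    exact: continuous_affine.
  exact: cf.
rewrite -RintegralZl//; last first.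
  apply: continuous_compact_integrable; first exact: segment_compact.
  exact: continuous_subspaceT.
have [u_eq0|u_neq0] := eqVneq u 0.
  by rewrite u_eq0 set_itv1 Rintegral_set1 mulr0 add0r subrr.
have u_gt0 : 0 < u by rewrite lt_neqAle eq_sym u_neq0.
have dFa (x : R) : is_derive x 1 (fun x => F (c * x + d)) (c * f (c * x + d)).
  have da : is_derive x 1 (fun x : R => c * x + d) c.
    have := is_deriveD (is_deriveZ c (is_derive_id x (1:R))) (is_derive_cst d x (1:R)).
    by rewrite addr0 /= [_ *: 1]mulr1.
  by rewrite mulrC; apply: is_derive1_comp; exact: dF.
rewrite /Rintegral (@continuous_FTC2 _ _ (fun x => F (c * x + d)))//=.
- by rewrite mulr0 add0r.
- apply: continuous_subspaceT => x; apply: cvgM; [exact: cvg_cst|exact: cfa].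
- split.
  + by move=> x _; have := dFa x => -[].
  + apply: cvg_at_right_filter; apply: differentiable_continuous.
    by apply/derivable1_diffP; have := dFa 0 => -[].
  + apply: cvg_at_left_filter; apply: differentiable_continuous.
    by apply/derivable1_diffP; have := dFa u => -[].
- by move=> x _; rewrite derive1E; have := dFa x => -[].
Qed.

End DeltaIntegral.

(** * Green formula for plane waves on the triangle *)

(** The frequencies of the six exponentials of TC_k, for (a, b) = (k_1 - k_3,
    k_2 - k_3). This is the orbit of (a, b) under the symmetry group of the
    triangle: three rotations, then three reflections. *)
Definition orbit6 (V : zmodType) (a b : V) : seq (V * V) :=
  [:: (a, b); (b - a, - a); (- b, a - b);
      (b - a, b); (- b, - a); (a, a - b)].

Section Green.
Variable R : realType.
Let mu := @lebesgue_measure R.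
Let mu2 := (mu \x mu)%E.

Definition int01_sin (c d : R) : R :=
  Rintegral (@lebesgue_measure R) `[0, 1] (fun x => sin (c * x + d)).

Definition intDelta_cos (p q s : R) : R :=
  Rintegral (@lebesgue_measure R \x @lebesgue_measure R)%E (@Delta R)
    (fun t => cos (p * t.1 + q * t.2 + s)).

Lemma integrable_sin (c d : R) :
  mu.-integrable `[0, 1] (EFin \o (fun x => sin (c * x + d))).
Proof.
apply: continuous_compact_integrable; first exact: segment_compact.
apply: continuous_subspaceT => x.
apply: (@continuous_comp _ _ _ (fun x => c * x + d) (@sin R)).
  exact: continuous_affine.
exact: continuous_sin.
Qed.

Lemma integral_cos_segment (c d u : R) : 0 <= u ->
  c * \int[mu]_(x in `[0, u]) cos (c * x + d) = sin (c * u + d) - sin d.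
Proof.
by move=> u0; apply: Rintegral_affine_FTC => //; exact: continuous_cos.
Qed.

Lemma int01_sinE (c d : R) : c * int01_sin c d = cos d - cos (c + d).
Proof.
have dNcos (x : R) : is_derive x 1 (fun x => - cos x) (sin x).
  by have := is_deriveN (is_derive_cos x); rewrite opprK.
rewrite /int01_sin (Rintegral_affine_FTC c d ler01 dNcos (@continuous_sin R)).
by rewrite mulr1 opprK addrC.
Qed.

(** The substitution x -> 1 - x, which reverses the direction of a side. *)
Lemma int01_sin_rev (c d : R) : int01_sin (- c) (c + d) = int01_sin c d.
Proof.
have [->|c0] := eqVneq c 0; first by rewrite oppr0 add0r.
by apply: (mulfI c0); apply: oppr_inj; rewrite -mulNr !int01_sinE addKr opprB.
Qed.

Lemma periodicz (f : R -> R) (T : R) : periodic f T ->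
  forall (m : int) x, f (x + T *~ m) = f x.
Proof.
move=> fT [k|k] x; first exact: periodicn.
by rewrite NegzE mulrNz -{2}(subrK (T *+ k.+1) x) periodicn.
Qed.

Lemma int01_sinD2pi (c d : R) (m : int) :
  int01_sin c (d + pi *+ 2 *~ m) = int01_sin c d.
Proof.
by apply: eq_Rintegral => x _; rewrite addrA (periodicz (@sinD2pi R)).
Qed.

Lemma measurable_plane_wave (p q s : R) :
  measurable_fun setT (fun t : R * R => cos (p * t.1 + q * t.2 + s)).
Proof.
apply: measurableT_comp.
  by apply: continuous_measurable_fun; exact: continuous_cos.
have m1 : measurable_fun [set: R * R] (fst : R * R -> R) by exact: measurable_fst.
have m2 : measurable_fun [set: R * R] (snd : R * R -> R) by exact: measurable_snd.
apply: measurable_funD => //; apply: measurable_funD.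
  exact: measurable_funM.
exact: measurable_funM.
Qed.

Lemma integrable_plane_wave (p q s : R) :
  mu2.-integrable (@Delta R) (EFin \o (fun t => cos (p * t.1 + q * t.2 + s))).
Proof.
apply: (integrable_Delta (measurable_plane_wave p q s) (M := 1)) => z.
exact: cos_max.
Qed.

(** q times the wave is the y-derivative of a sine, so that integrating first
    in y leaves the difference of two integrals along sides of the triangle. *)
Lemma intDelta_cos_y (p q s : R) :
  q * intDelta_cos p q s = int01_sin (p - q) (q + s) - int01_sin p s.
Proof.
have mw := measurable_plane_wave p q s.
rewrite /intDelta_cos -RintegralZl; last 2 first.
- exact: measurable_Delta.
- exact: integrable_plane_wave.
rewrite (@Rintegral_Delta12 _ _ `|q|); last first.
- by move=> z; rewrite normrM ler_piMr// cos_max.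
- by apply: measurable_funM => //; exact: measurable_cst.
rewrite -RintegralB//; [|exact: integrable_sin|exact: integrable_sin].
apply: eq_Rintegral => x; rewrite inE/= in_itv/= => /andP[x0 x1].
have x1' : 0 <= 1 - x by rewrite subr_ge0.
have := integral_cos_segment q (p * x + s) x1'.
rewrite -RintegralZl//; last first.
  apply: continuous_compact_integrable; first exact: segment_compact.
  apply: continuous_subspaceT => y.
  apply: (@continuous_comp _ _ _ (fun y => q * y + (p * x + s)) (@cos R)).
    exact: continuous_affine.
  exact: continuous_cos.
have -> : q * (1 - x) + (p * x + s) = (p - q) * x + (q + s) by ring.
move=> <-; apply: eq_Rintegral => y _; congr (_ * cos _).
by rewrite /= addrCA addrA.
Qed.

Lemma intDelta_cos_swap (p q s : R) : intDelta_cos p q s = intDelta_cos q p s.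
Proof.
rewrite /intDelta_cos (Rintegral_Delta12 (measurable_plane_wave p q s)
  (fun z => cos_max _)).
rewrite (Rintegral_Delta21 (measurable_plane_wave q p s) (fun z => cos_max _)).
by apply: eq_Rintegral => x _; apply: eq_Rintegral => y _ /=; rewrite (addrC (p * x)).
Qed.

Lemma intDelta_cos_x (p q s : R) :
  p * intDelta_cos p q s = int01_sin (p - q) (q + s) - int01_sin q s.
Proof.
rewrite intDelta_cos_swap intDelta_cos_y -(int01_sin_rev (q - p)) opprB.
by have -> : q - p + (p + s) = q + s by ring.
Qed.

(** Green's formula for one wave: the three terms are the fluxes of the gradient,
    for the quadratic form p^2 - p q + q^2, through the three sides. *)
Lemma intDelta_cos_green (p q s : R) :
  2 * (p ^+ 2 - p * q + q ^+ 2) * intDelta_cos p q s =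
  (p + q) * int01_sin (p - q) (q + s)
  - (2 * p - q) * int01_sin q s - (2 * q - p) * int01_sin p s.
Proof.
have -> : 2 * (p ^+ 2 - p * q + q ^+ 2) * intDelta_cos p q s =
  (2 * p - q) * (p * intDelta_cos p q s) + (2 * q - p) * (q * intDelta_cos p q s) by ring.
by rewrite intDelta_cos_x intDelta_cos_y; ring.
Qed.

(** On each side the waves of the orbit coincide in pairs with opposite fluxes.
    On the side x + y = 1 they do so only up to a phase, a multiple of 2 pi
    because all second components of the orbit are congruent to - a modulo 3.
    The free phase s covers real and imaginary parts at once. *)
Lemma intDelta_cos_orbit6 (a b m : int) (al s : R) : al *+ 3 = pi *+ 2 ->
  b = 3 * m - a -> a ^+ 2 - a * b + b ^+ 2 != 0 ->
  \sum_(k <- orbit6 a b) intDelta_cos (al * k.1%:~R) (al * k.2%:~R) s = 0.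
Proof.
move=> al3 bE Q0; rewrite !big_cons big_nil/= addr0.
pose A := al * a%:~R; pose B := al * b%:~R.
have al0 : al != 0.
  apply: contra_eq_neq al3 => ->; rewrite mul0rn eq_sym mulrn_eq0/=.
  by rewrite gt_eqF// pi_gt0.
(* p^2 - p q + q^2 takes the same value on the whole orbit. *)
have Q0' : 2 * (A ^+ 2 - A * B + B ^+ 2) != 0.
  rewrite mulf_neq0// /A /B.
  have -> : (al * a%:~R) ^+ 2 - (al * a%:~R) * (al * b%:~R) + (al * b%:~R) ^+ 2 =
    al ^+ 2 * (a ^+ 2 - a * b + b ^+ 2)%:~R :> R.
    by ring.
  by rewrite mulf_neq0// ?expf_neq0// intr_eq0.
apply: (mulfI Q0'); rewrite mulr0.
have BE : B = - A + pi *+ 2 *~ m.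
  by rewrite -al3 /B /A bE -mulrzl -mulr_natr; ring.
have ABE : A - B = - A + pi *+ 2 *~ (a - m).
  by rewrite -al3 /B /A bE -mulrzl -mulr_natr; ring.
rewrite !rmorphB !rmorphN/= !mulrBr !mulrN -/A -/B.
have JB c : int01_sin c (B + s) = int01_sin c (- A + s).
  by rewrite BE addrAC int01_sinD2pi.
have JAB c : int01_sin c (A - B + s) = int01_sin c (- A + s).
  by rewrite ABE addrAC int01_sinD2pi.
set K := 2 * _; have G p q : p ^+ 2 - p * q + q ^+ 2 = A ^+ 2 - A * B + B ^+ 2 ->
   K * intDelta_cos p q s =
  (p + q) * int01_sin (p - q) (q + s)
  - (2 * p - q) * int01_sin q s - (2 * q - p) * int01_sin p s.
  by rewrite /K => <-; exact: intDelta_cos_green.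
rewrite !mulrDr !G; try by ring.
rewrite !JAB !JB.
have -> : B - A - - A = B by ring.
have -> : - B - (A - B) = - A by ring.
have -> : B - A - B = - A by ring.
have -> : - B - - A = A - B by ring.
have -> : A - (A - B) = B by ring.
ring.
Qed.

Lemma fine_mu_segment (u : R) : 0 <= u -> fine (mu `[0, u]) = u.
Proof.
rewrite le_eqVlt /mu lebesgue_measure_itv/= lte_fin => /predU1P[<-|u0].
  by rewrite ltxx.
by rewrite u0 /= oppr0 addr0.
Qed.

(** The frequency 0, where Green's formula is void: half of cos s, since the
    triangle has area 1/2. *)
Lemma intDelta_cos0 (s : R) : intDelta_cos 0 0 s = 2^-1 * cos s.
Proof.
rewrite /intDelta_cos (Rintegral_Delta12 (measurable_plane_wave 0 0 s)
  (fun z => cos_max _)).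
have dsqr (x : R) : is_derive x 1 (fun x => 2^-1 * x ^+ 2) x.
  have := is_deriveZ (2^-1) (is_deriveX 2 (is_derive_id x (1:R))).
  by rewrite /= expr1 [_%:A]mulr1 [_ *: _]mulKf.
have half : \int[mu]_(x in `[0, 1]) (- 1 * x + 1) = 2^-1.
  have := Rintegral_affine_FTC (-1) 1 ler01 dsqr (fun x => cvg_id).
  by rewrite mulN1r mulr1 addNr expr0n mulr0 sub0r expr1n mulr1 => /oppr_inj.
rewrite mulrC -half -RintegralZl//; last first.
  apply: continuous_compact_integrable; first exact: segment_compact.
  apply: continuous_subspaceT; exact: continuous_affine.
apply: eq_Rintegral => x; rewrite inE/= in_itv/= => /andP[x0 x1].
under eq_Rintegral do rewrite /= !mul0r !add0r.
rewrite Rintegral_cst// fine_mu_segment ?subr_ge0//.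
by rewrite mulN1r addrC.
Qed.

End Green.

(** * Discrete Green formula on the triangle *)

Definition geom_sum (F : fieldType) n (x : F) : F := \sum_(0 <= i < n.+1) x ^+ i.

Definition edge_sum (F : fieldType) n (x y : F) : F :=
  \sum_(0 <= i < n.+1) x ^+ i * y ^+ (n - i).

Definition tri_sum (F : fieldType) n (x y : F) : F :=
  \sum_(0 <= i < n.+1) \sum_(0 <= j < (n - i).+1) x ^+ i * y ^+ j.

(** The cubature sum of the wave (i, j) |-> x^i y^j. The weights 6, 3, 1 arise
    as 6 everywhere, minus 3 on each of the three sides, plus 1 at each
    corner. *)
Definition weighted_sum (F : fieldType) n (x y : F) : F :=
  6 * tri_sum n x y
  - 3 * (geom_sum n y + geom_sum n x + edge_sum n x y) + (1 + x ^+ n + y ^+ n).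

(** Eigenvalue on the wave (i, j) |-> x^i y^j of the difference Laplacian whose
    six steps are (1, 0), (0, 1), (1, -1) and their opposites. *)
Definition lattice_laplacian (F : fieldType) (x y : F) : F :=
  x + x^-1 + y + y^-1 + x / y + y / x - 6.

Section TriangleSums.
Variable F : fieldType.
Implicit Types x y u v w : F.

Lemma geom_sumP n x : (x - 1) * geom_sum n x = x ^+ n.+1 - 1.
Proof.
by rewrite /geom_sum big_mkord -subrX1.
Qed.

Lemma edge_sumSr n x y : edge_sum n.+1 x y = y * edge_sum n x y + x ^+ n.+1.
Proof.
rewrite /edge_sum big_nat_recr//= subnn mulr1; congr (_ + _).
rewrite big_distrr/=; apply: eq_big_nat => i /andP[_ lin].
by rewrite subSn// exprS mulrCA.
Qed.

Lemma edge_sumSl n x y : edge_sum n.+1 x y = x * edge_sum n x y + y ^+ n.+1.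
Proof.
rewrite /edge_sum big_nat_recl//= mul1r subn0 addrC; congr (_ + _).
by rewrite big_distrr/=; apply: eq_big_nat => i _; rewrite exprS subSS mulrA.
Qed.

Lemma edge_sum_geom n x y : y != 0 -> edge_sum n x y = y ^+ n * geom_sum n (x / y).
Proof.
move=> y0; rewrite /edge_sum /geom_sum big_distrr/=.
apply: eq_big_nat => i /andP[_ lin]; rewrite exprMn exprVn mulrCA.
by rewrite exprB ?unitfE.
Qed.

Lemma tri_sumS n x y : tri_sum n.+1 x y = tri_sum n x y + edge_sum n.+1 x y.
Proof.
rewrite /tri_sum /edge_sum !(big_nat_recr n.+1)//= subnn big_nat1 addrA.
congr (_ + _); rewrite -big_split/=; apply: eq_big_nat => i /andP[_ lin].
by rewrite subSn// big_nat_recr.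
Qed.

(** This lemma and the next two: a difference in each of the three lattice
    directions turns the sum over the triangle into sums over two sides. *)
Lemma tri_sum_x n x y : (x - 1) * tri_sum n x y = x * edge_sum n x y - geom_sum n y.
Proof.
elim: n => [|n IHn].
  by rewrite /tri_sum /edge_sum /geom_sum !big_nat1 !mulr1.
have -> : geom_sum n.+1 y = geom_sum n y + y ^+ n.+1.
  by rewrite /geom_sum big_nat_recr.
by rewrite tri_sumS mulrDr IHn edge_sumSl; ring.
Qed.

Lemma tri_sum_y n x y : (y - 1) * tri_sum n x y = y * edge_sum n x y - geom_sum n x.
Proof.
elim: n => [|n IHn].
  by rewrite /tri_sum /edge_sum /geom_sum !big_nat1 !mulr1.
have -> : geom_sum n.+1 x = geom_sum n x + x ^+ n.+1.
  by rewrite /geom_sum big_nat_recr.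
by rewrite tri_sumS mulrDr IHn edge_sumSr; ring.
Qed.

Lemma tri_sum_xy n x y :
  (x - y) * tri_sum n x y = x * geom_sum n x - y * geom_sum n y.
Proof.
have -> : (x - y) * tri_sum n x y = (x - 1) * tri_sum n x y - (y - 1) * tri_sum n x y.
  by ring.
have E : (x - y) * edge_sum n x y = (x - 1) * geom_sum n x - (y - 1) * geom_sum n y.
  have xn : x ^+ n.+1 = x * edge_sum n x y + y ^+ n.+1 - y * edge_sum n x y.
    by rewrite -edge_sumSl edge_sumSr addrAC subrr add0r.
  by rewrite !geom_sumP xn; ring.
have -> : (x - 1) * tri_sum n x y - (y - 1) * tri_sum n x y =
  (x - y) * edge_sum n x y + geom_sum n x - geom_sum n y.
  by rewrite tri_sum_x tri_sum_y; ring.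
by rewrite E; ring.
Qed.

(** The flux through a side on which the wave restricts to the powers of x. By
    symmetry a single formula serves the three sides. *)
Definition edge_defect n x y : F :=
  (6 * ((1 + x) / y - 2) - 3 * lattice_laplacian x y) * geom_sum n x.

Lemma laplacian_weighted_sum n x y : x != 0 -> y != 0 ->
  lattice_laplacian x y * weighted_sum n x y =
  edge_defect n x y + edge_defect n y x + y ^+ n * edge_defect n (x / y) (y^-1)
  + lattice_laplacian x y * (1 + x ^+ n + y ^+ n).
Proof.
move=> x0 y0; rewrite /edge_defect.
rewrite [y ^+ n * _]mulrCA -edge_sum_geom//.
have L : lattice_laplacian x y * tri_sum n x y =
    (1 - x^-1) * (x * edge_sum n x y - geom_sum n y)
    + (1 - y^-1) * (y * edge_sum n x y - geom_sum n x)
    + (y^-1 - x^-1) * (x * geom_sum n x - y * geom_sum n y).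
  rewrite -tri_sum_x -tri_sum_y -tri_sum_xy /lattice_laplacian.
  by field; rewrite x0.
have -> : lattice_laplacian x y * weighted_sum n x y =
  6 * (lattice_laplacian x y * tri_sum n x y) + lattice_laplacian x y *
  (- 3 * (geom_sum n y + geom_sum n x + edge_sum n x y) + (1 + x ^+ n + y ^+ n)).
  by rewrite /weighted_sum; ring.
by rewrite L /lattice_laplacian; field; rewrite x0 y0 oner_neq0.
Qed.

(** Reflection in a side exchanges y and x / y. The sum of the two fluxes has the
    factor (x - 1), hence telescopes to the two ends of the side. *)
Lemma edge_defect_pair n x y : x != 0 -> y != 0 ->
  edge_defect n x y + edge_defect n x (x / y) = -6 * (1 - x^-1) * (x ^+ n.+1 - 1).
Proof.
move=> x0 y0; rewrite -geom_sumP /edge_defect /lattice_laplacian.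
by field; rewrite ?x0 ?y0 ?oner_neq0.
Qed.

(** The six pairs are the orbit of (x, y) written multiplicatively. The
    hypotheses on w say that a wave takes the values 1, w, w^2 at the corners
    and that these agree for the six waves. *)
Lemma laplacian_orbit_sum n x y w : x != 0 -> y != 0 ->
    x ^+ n = w -> y ^+ n = w ^+ 2 -> w ^+ 3 = 1 ->
  lattice_laplacian x y *
   (weighted_sum n x y + weighted_sum n (y / x) x^-1 + weighted_sum n y^-1 (x / y)
    + weighted_sum n (y / x) y + weighted_sum n y^-1 x^-1
    + weighted_sum n x (x / y)) = 0.
Proof.
move=> x0 y0 xn yn w3.
have w0 : w != 0 by apply: contra_eq_neq w3 => ->; rewrite expr0n eq_sym oner_eq0.
have xVn : x^-1 ^+ n = w ^+ 2.
  by rewrite exprVn xn; apply: (mulfI w0); rewrite divff// -exprS w3.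
have yVn : y^-1 ^+ n = w.
  rewrite exprVn yn; apply: (mulfI (expf_neq0 2 w0)).
  by rewrite divff ?expf_neq0// -exprSr w3.
have xyn : (x / y) ^+ n = w ^+ 2 by rewrite exprMn yVn xn.
have yxn : (y / x) ^+ n = w.
  by rewrite exprMn yn xVn -exprD exprS w3 mulr1.
have [xV0 yV0] : x^-1 != 0 /\ y^-1 != 0 by rewrite !invr_eq0.
have [xy0 yx0] : x / y != 0 /\ y / x != 0 by rewrite !mulf_neq0.
set L := lattice_laplacian x y; have L1 : L = lattice_laplacian x y by [].
have L2 : L = lattice_laplacian (y / x) x^-1.
  by rewrite /L /lattice_laplacian; field; rewrite ?x0 ?y0 ?oner_neq0.
have L3 : L = lattice_laplacian y^-1 (x / y).
  by rewrite /L /lattice_laplacian; field; rewrite ?x0 ?y0 ?oner_neq0.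
have L4 : L = lattice_laplacian (y / x) y.
  by rewrite /L /lattice_laplacian; field; rewrite ?x0 ?y0 ?oner_neq0.
have L5 : L = lattice_laplacian y^-1 x^-1.
  by rewrite /L /lattice_laplacian; field; rewrite ?x0 ?y0 ?oner_neq0.
have L6 : L = lattice_laplacian x (x / y).
  by rewrite /L /lattice_laplacian; field; rewrite ?x0 ?y0 ?oner_neq0.
clearbody L; rewrite ![L * (_ + weighted_sum _ _ _)]mulrDr {1}L1 {1}L2 {1}L3.
rewrite {1}L4 {1}L5 {1}L6 !laplacian_weighted_sum//.
rewrite -L1 -L2 -L3 -L4 -L5 -L6.
rewrite !xn !yn !xVn !yVn !xyn !yxn.
have -> : y / x / x^-1 = y by field; rewrite ?x0 ?y0 ?oner_neq0.
have -> : y^-1 / (x / y) = x^-1 by field; rewrite ?x0 ?y0 ?oner_neq0.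
have -> : y / x / y = x^-1 by field; rewrite ?x0 ?y0 ?oner_neq0.
have -> : y^-1 / x^-1 = x / y by field; rewrite ?x0 ?y0 ?oner_neq0.
have -> : x / (x / y) = y by field; rewrite ?x0 ?y0 ?oner_neq0.
rewrite !invrK invf_div.
have P1 := edge_defect_pair n x0 y0.
have := edge_defect_pair n yx0 y0.
have -> : y / x / y = x^-1 by field; rewrite ?x0 ?y0 ?oner_neq0.
move=> P2; have := edge_defect_pair n yV0 xV0.
have -> : y^-1 / x^-1 = x / y by field; rewrite ?x0 ?y0 ?oner_neq0.
move=> P3; have Q1 := edge_defect_pair n y0 x0.
have := edge_defect_pair n xV0 yV0.
have -> : x^-1 / y^-1 = y / x by field; rewrite ?x0 ?y0 ?oner_neq0.
move=> Q2; have := edge_defect_pair n xy0 x0.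
have -> : x / y / x = y^-1 by field; rewrite ?x0 ?y0 ?oner_neq0.
move=> Q3.
transitivity (edge_defect n x y + edge_defect n x (x / y)
   + (edge_defect n (y / x) y + edge_defect n (y / x) x^-1)
   + (edge_defect n y^-1 x^-1 + edge_defect n y^-1 (x / y))
   + (1 + w ^+ 2) * (edge_defect n y x + edge_defect n y (y / x)
      + (edge_defect n x^-1 y^-1 + edge_defect n x^-1 (y / x))
      + (edge_defect n (x / y) x + edge_defect n (x / y) y^-1))
   + 6 * L * (1 + w + w ^+ 2)); first by ring.
rewrite P1 P2 P3 Q1 Q2 Q3 !exprS xn yn xVn yVn xyn yxn.
(* Modulo w^3 = 1 the edge terms add up to - 6 L (1 + w + w^2), so only a
   multiple of w^3 - 1 remains. *)
transitivity (-6 * w * (w ^+ 3 - 1) * (x^-1 + x / y + y - 3)).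
  by rewrite L1 /lattice_laplacian; field; rewrite ?x0 ?y0 ?oner_neq0.
by rewrite w3 subrr mulr0 mul0r.
Qed.

Lemma weighted_sum11 n : weighted_sum n 1 1 = 3 * n%:R ^+ 2 :> F.
Proof.
have G m : geom_sum m (1 : F) = m.+1%:R.
  rewrite /geom_sum big_mkord; under eq_bigr do rewrite expr1n.
  by rewrite sumr_const card_ord.
have T m : 2 * tri_sum m (1 : F) 1 = m.+1%:R * m.+2%:R.
  elim: m => [|m IHm]; first by rewrite /tri_sum !big_nat1 !mulr1 mul1r.
  rewrite tri_sumS mulrDr IHm edge_sum_geom ?oner_neq0// divr1 G expr1n.
  by rewrite -(natr1 m.+2) -(natr1 m.+1); ring.
rewrite /weighted_sum edge_sum_geom ?oner_neq0// divr1 !G !expr1n.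
have -> : 6 * tri_sum n (1 : F) 1 = 3 * (2 * tri_sum n (1 : F) 1) by ring.
by rewrite T -(natr1 n.+1) -(natr1 n); ring.
Qed.

End TriangleSums.

(** * The cubature weights *)

Lemma vec3E (V : Type) (a b c : V) :
  (vec3 a b c 0 0 = a) * (vec3 a b c 0 1 = b) * (vec3 a b c 0 2 = c).
Proof. by rewrite !mxE. Qed.

Lemma vec3_eq (a b c a' b' c' : int) :
  (vec3 a b c == vec3 a' b' c') = [&& a == a', b == b' & c == c'].
Proof.
apply/eqP/and3P => [/rowP E|[/eqP-> /eqP-> /eqP->]//].
by have := E 0; have := E 1; have := E 2; rewrite !vec3E => -> -> ->; rewrite !eqxx.
Qed.

(** Written additively because the subtraction of nat truncates. *)
Lemma lambdaE n i j : (0 < n)%N -> (i <= n)%N -> (j <= n - i)%N ->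
  (lambda n (vec3 i%:Z j%:Z (- i%:Z - j%:Z)%R)
     + 3 * ((i == 0) + (j == 0) + (j == n - i))
   = 6 + ((i == 0) && (j == 0)) + ((i == n) && (j == 0))
       + ((i == 0) && (j == n)))%N.
Proof.
move=> n0 lin ljn; rewrite /lambda !inE !vec3_eq !vec3E.
case: ifPn => H1; last case: ifPn => H2; lia.
Qed.

Lemma sum_pick (F : fieldType) (m k : nat) (g : nat -> F) : (k < m)%N ->
  \sum_(0 <= j < m) (j == k)%:R * g j = g k.
Proof.
move=> km; rewrite (bigD1_seq k) ?mem_index_iota ?iota_uniq//= eqxx mul1r.
by rewrite big1 ?addr0// => j /negPf ->; rewrite mul0r.
Qed.

Lemma sum_lambda (F : fieldType) n (f : nat -> nat -> F) : (0 < n)%N ->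
  \sum_(0 <= i < n.+1) \sum_(0 <= j < (n - i).+1)
     (lambda n (vec3 i%:Z j%:Z (- i%:Z - j%:Z)))%:R * f i j
  = 6 * (\sum_(0 <= i < n.+1) \sum_(0 <= j < (n - i).+1) f i j)
    - 3 * (\sum_(0 <= j < n.+1) f 0 j + \sum_(0 <= i < n.+1) f i 0
           + \sum_(0 <= i < n.+1) f i (n - i)%N)
    + (f 0 0 + f n 0 + f 0 n).
Proof.
move=> n0.
have row k (g : nat -> nat -> F) : (k <= n)%N ->
   \sum_(0 <= i < n.+1) \sum_(0 <= j < (n - i).+1) (i == k)%:R * g i j =
   \sum_(0 <= j < (n - k).+1) g k j.
  move=> kn; under eq_bigr do rewrite -big_distrr/=.
  exact: (sum_pick (fun i => \sum_(0 <= j < (n - i).+1) g i j)).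
have column (k : nat -> nat) (g : nat -> nat -> F) :
   (forall i, (i <= n)%N -> (k i <= n - i)%N) ->
   \sum_(0 <= i < n.+1) \sum_(0 <= j < (n - i).+1) (j == k i)%:R * g i j =
   \sum_(0 <= i < n.+1) g i (k i).
  move=> kn; apply: eq_big_nat => i /andP[_ lin].
  by rewrite sum_pick// ltnS kn.
transitivity (\sum_(0 <= i < n.+1) \sum_(0 <= j < (n - i).+1)
   (6 * f i j - 3 * ((i == 0%N)%:R * f i j + (j == 0%N)%:R * f i j
      + (j == (n - i)%N)%:R * f i j)
    + ((i == 0%N)%:R * ((j == 0%N)%:R * f i j)
    + (i == n)%:R * ((j == 0%N)%:R * f i j)
    + (i == 0%N)%:R * ((j == n)%:R * f i j)))).
  apply: eq_big_nat => i /andP[_ lin]; apply: eq_big_nat => j /andP[_ ljn].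
  have /(congr1 (fun m : nat => m%:R : F)) := lambdaE n0 lin ljn.
  rewrite !(natrD, natrM) -!mulnb !natrM => E.
  rewrite -[_%:R in LHS]
    (addrK (3%:R * ((i == 0%N)%:R + (j == 0%N)%:R + (j == (n - i)%N)%:R))).
  by rewrite E; ring.
under eq_bigr do rewrite big_split sumrB/= -!big_distrr !big_split/=.
rewrite big_split sumrB/= -!big_distrr/= !big_split/=.
rewrite !row// (column (fun=> 0%N))// (column (fun i => n - i)%N)//.
by rewrite subn0 subnn !sum_pick.
Qed.

Lemma sum_lambda_powers (F : fieldType) n (x y : F) : (0 < n)%N ->
  \sum_(0 <= i < n.+1) \sum_(0 <= j < (n - i).+1)
     (lambda n (vec3 i%:Z j%:Z (- i%:Z - j%:Z)))%:R * (x ^+ i * y ^+ j)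
  = weighted_sum n x y.
Proof.
move=> n0; rewrite (sum_lambda (fun i j => x ^+ i * y ^+ j))//.
rewrite /weighted_sum /tri_sum /geom_sum /edge_sum !expr0 !mulr1 !mul1r.
by congr (_ - 3 * (_ + _ + _) + _); apply: eq_bigr => j _; rewrite ?mul1r ?mulr1.
Qed.

(** * Plane waves *)

Section Cis.
Variable R : realType.

Definition cis (x : R) : R[i] := cos x +i* sin x.

Lemma cisD x y : cis (x + y) = cis x * cis y.
Proof. by rewrite /cis cosD sinD; simpc; congr (_ +i* _); rewrite addrC. Qed.

Lemma cis0 : cis 0 = 1.
Proof. by rewrite /cis cos0 sin0. Qed.

Lemma cis_neq0 x : cis x != 0.
Proof.
rewrite eq_complex/=; apply/negP => /andP[/eqP c0 /eqP s0].
by have /eqP := cos2Dsin2 x; rewrite c0 s0 !expr0n addr0 eq_sym oner_eq0.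
Qed.

Lemma cisN x : cis (- x) = (cis x)^-1.
Proof. by apply: (mulfI (cis_neq0 x)); rewrite -cisD subrr cis0 divff// cis_neq0. Qed.

Lemma cisMn x n : cis (x *+ n) = cis x ^+ n.
Proof. by elim: n => [|n IHn]; rewrite ?mulr0n ?cis0// mulrS cisD IHn exprS. Qed.

Lemma cis_2piz (m : int) : cis (pi *+ 2 *~ m) = 1.
Proof.
rewrite /cis -[pi *+ 2 *~ m]add0r (periodicz (@cosD2pi R)) (periodicz (@sinD2pi R)).
by rewrite cos0 sin0.
Qed.

Lemma cisDV x : cis x + (cis x)^-1 = (2 * cos x)%:C.
Proof. by rewrite mulr_natl -cisN /cis cosN sinN; simpc. Qed.

Lemma cos_lt1 (x : R) : 0 < x < pi *+ 2 -> cos x < 1.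
Proof.
move=> /andP[x0 x2].
have -> : x = (x / 2) *+ 2 by rewrite -mulr_natr divfK.
rewrite cos_mulr2n cos2sin2 -subr_gt0.
have : 0 < sin (x / 2).
  apply: sin_gt0_pi; apply/andP; split; first by rewrite divr_gt0.
  by rewrite ltr_pdivrMr// mulr_natr.
by move=> /(exprn_gt0 2) s2; lra.
Qed.

(** On the unit circle the eigenvalue is
    2 cos x + 2 cos y + 2 cos (x - y) - 6, negative as soon as one cosine is
    less than 1. *)
Lemma lattice_laplacian_cis_neq0 (x y : R) :
  (0 < x < pi *+ 2) || (0 < y < pi *+ 2) -> lattice_laplacian (cis x) (cis y) != 0.
Proof.
move=> xy.
have -> : lattice_laplacian (cis x) (cis y) =
    (2 * cos x + 2 * cos y + 2 * cos (x - y) - 6)%:C.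
  rewrite rmorphB rmorph_nat !rmorphD/= -!cisDV cisD cisN /lattice_laplacian.
  by rewrite invf_div; ring.
rewrite (inj_eq (@complexI R) _ 0) lt_eqF//.
have := cos_le1 x; have := cos_le1 y; have := cos_le1 (x - y).
by move: xy => /orP[/cos_lt1|/cos_lt1]; lra.
Qed.

Lemma cexp_imaginary (r : R) :
  cexp ((2 * pi)%:C * 'i%C / 3 * r%:C) = cis (2 * pi / 3 * r).
Proof.
have -> : (2 * pi)%:C * 'i%C / 3 * r%:C = 0 +i* (2 * pi / 3 * r) :> R[i].
  rewrite -[3](rmorph_nat (real_complex R)) -fmorphV/=.
  by simpc; congr (_ +i* _); ring.
by rewrite /cexp/= expR0 mul1r.
Qed.

Lemma phi_vec3 (k1 k2 k3 : int) (x y : R) :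
  phi (vec3 k1 k2 k3) (vec3 x y (- x - y)) =
  cis (2 * pi / 3 * (k1 - k3)%:~R * x + 2 * pi / 3 * (k2 - k3)%:~R * y).
Proof.
rewrite /phi cexp_imaginary /dotH !big_ord_recl big_ord0 !mxE; congr cis.
by rewrite /tnth/=; ring.
Qed.

Definition wave (p q : int) (x y : R) : R[i] :=
  cis (2 * pi / 3 * p%:~R * x + 2 * pi / 3 * q%:~R * y).

Lemma TC_orbit6 (k : 'rV[int]_3) (x y : R) :
  TC k (vec3 x y (- x - y)) =
  6^-1 * \sum_(pq <- orbit6 (k 0 0 - k 0 2) (k 0 1 - k 0 2)) wave pq.1 pq.2 x y.
Proof.
rewrite /TC !phi_vec3 !big_cons big_nil/= /wave addr0 !addrA.
by congr (_ * (_ + _ + _ + _ + _ + _));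
  congr (cis (_ * intmul 1 _ * _ + _ * intmul 1 _ * _)); ring.
Qed.

End Cis.

(** * Integrals of complex-valued functions *)

Section ComplexIntegral.
Context d (T : measurableType d) (R : realType).
Variables (mu : {measure set T -> \bar R}) (D : set T).
Hypothesis mD : measurable D.

(** Records integrability along with the value, since linearity of the
    integral requires both. *)
Definition is_cintegral (g : T -> R[i]) (v : R[i]) :=
  [/\ mu.-integrable D (EFin \o (fun x => complex.Re (g x))),
      mu.-integrable D (EFin \o (fun x => complex.Im (g x)))
    & cintegral mu D g = v].

Lemma is_cintegral_eq g h v : {in D, g =1 h} -> is_cintegral g v -> is_cintegral h v.
Proof.
move=> gh [ig1 ig2 <-]; split.
- by apply: eq_integrable ig1 => // x /gh /= ->.
- by apply: eq_integrable ig2 => // x /gh /= ->.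
- by rewrite /cintegral; congr (_ +i* _); apply: eq_Rintegral => x /gh ->.
Qed.

Lemma is_cintegralD g h v w : is_cintegral g v -> is_cintegral h w ->
  is_cintegral (fun x => g x + h x) (v + w).
Proof.
move=> [ig1 ig2 <-] [ih1 ih2 <-]; split.
- have := integrableD mD ig1 ih1; apply: eq_integrable => // x _ /=.
  by rewrite -EFinD; case: (g x) (h x) => [? ?] [? ?].
- have := integrableD mD ig2 ih2; apply: eq_integrable => // x _ /=.
  by rewrite -EFinD; case: (g x) (h x) => [? ?] [? ?].
- rewrite /cintegral; simpc; rewrite -!RintegralD//.
  by congr (_ +i* _); apply: eq_Rintegral => x _; case: (g x) (h x) => [? ?] [? ?].
Qed.

Lemma is_cintegralZ (c : R[i]) g v : is_cintegral g v ->
  is_cintegral (fun x => c * g x) (c * v).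
Proof.
case: c => [a b] [ig1 ig2 <-].
have iZ (r : R) (f : T -> R) : mu.-integrable D (EFin \o f) ->
    mu.-integrable D (EFin \o (fun x => r * f x)).
  move=> If; have := integrableZl mD r If.
  by apply: eq_integrable => // x _ /=; rewrite EFinM.
have iZB (r s : R) (f h : T -> R) : mu.-integrable D (EFin \o f) ->
    mu.-integrable D (EFin \o h) ->
    mu.-integrable D (EFin \o (fun x => r * f x + s * h x)).
  move=> /(iZ r) If /(iZ s) Ih; have := integrableD mD If Ih.
  by apply: eq_integrable => // x _ /=; rewrite EFinD.
have RE x : complex.Re ((a +i* b) * g x) = a * complex.Re (g x) + - b * complex.Im (g x).
  by case: (g x) => [? ?] /=; rewrite mulNr.
have IE x : complex.Im ((a +i* b) * g x) = b * complex.Re (g x) + a * complex.Im (g x).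
  by case: (g x) => [? ?] /=; rewrite addrC.
split.
- by apply: eq_integrable (iZB a (- b) _ _ ig1 ig2) => // x _ /=; rewrite RE.
- by apply: eq_integrable (iZB b a _ _ ig1 ig2) => // x _ /=; rewrite IE.
- rewrite /cintegral.
  under eq_Rintegral do rewrite RE; under [X in _ +i* X]eq_Rintegral do rewrite IE.
  rewrite !RintegralD//; try exact: iZ.
  by rewrite !RintegralZl//; simpc; congr (_ +i* _); ring.
Qed.

Lemma is_cintegral0 : is_cintegral (fun=> 0) 0.
Proof.
have i0 : mu.-integrable D (EFin \o (fun=> 0 : R)) by exact: integrable0.
by split; rewrite // /cintegral /= /Rintegral integral0.
Qed.

Lemma is_cintegral_sum (I : eqType) (s : seq I) (g : I -> T -> R[i]) (v : I -> R[i]) :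
  (forall i, i \in s -> is_cintegral (g i) (v i)) ->
  is_cintegral (fun x => \sum_(i <- s) g i x) (\sum_(i <- s) v i).
Proof.
elim: s => [|i s IHs] H.
  rewrite big_nil; apply: is_cintegral_eq is_cintegral0 => x _.
  by rewrite big_nil.
rewrite big_cons; apply: (@is_cintegral_eq (fun x => g i x + \sum_(i <- s) g i x)).
  by move=> x _; rewrite big_cons.
apply: is_cintegralD; first by apply: H; rewrite mem_head.
by apply: IHs => j js; apply: H; rewrite inE js orbT.
Qed.

End ComplexIntegral.

(** * Exactness of the cubature *)

(** Everything that is used about the index set: positivity makes the eigenvalues
    nonzero, b = - a modulo 3 makes the boundary phases agree, and the bound on
    a + b carries the degree. *)
Lemma Lambda_frequencies m (k : 'rV[int]_3) : k \in Lambda m -> k != 0 ->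
  let a := k 0 0 - k 0 2 in let b := k 0 1 - k 0 2 in
  [/\ 0 < a, 0 < b, b = 3 * (k 0 0 + k 0 1) - a & a + b <= 3 * m%:Z].
Proof.
rewrite !inE => /and4P[/eqP kH k1 k2 k3] k0.
have : (k 0 0 != 0) || (k 0 1 != 0).
  apply: contraNT k0; rewrite negb_or !negbK => /andP[/eqP z1 /eqP z2].
  move: kH; rewrite z1 z2 !add0r => z3.
  apply/eqP/rowP => i; rewrite mxE.
  case: i => [[|[|[|//]]] H].
  - by rewrite (_ : Ordinal H = 0)//; exact: val_inj.
  - by rewrite (_ : Ordinal H = 1)//; exact: val_inj.
  - by rewrite (_ : Ordinal H = 2)//; exact: val_inj.
move: kH k1 k2 k3; move: (k 0 0) (k 0 1) (k 0 2) => x y z.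
by move=> ? ? ? ? ?; split; lia.
Qed.

Lemma sum_complex (R : realType) (I : Type) (s : seq I) (F G : I -> R) :
  \sum_(i <- s) (F i +i* G i) = (\sum_(i <- s) F i) +i* (\sum_(i <- s) G i).
Proof.
by elim: s => [|i s IHs]; rewrite ?big_nil// !big_cons IHs; simpc.
Qed.

Section Exactness.
Variable R : realType.
Let mu2 := (@lebesgue_measure R \x @lebesgue_measure R)%E.

Lemma wave_cintegral (p q : int) :
  is_cintegral mu2 (@Delta R) (fun t => wave p q t.1 t.2)
    (intDelta_cos (2 * pi / 3 * p%:~R) (2 * pi / 3 * q%:~R) 0
     +i* intDelta_cos (2 * pi / 3 * p%:~R) (2 * pi / 3 * q%:~R) (- (pi / 2))).
Proof.
split.
- have := integrable_plane_wave (2 * pi / 3 * p%:~R) (2 * pi / 3 * q%:~R) (0 : R).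
  apply: eq_integrable; first exact: measurable_Delta.
  by move=> t _ /=; rewrite addr0.
- have := integrable_plane_wave (2 * pi / 3 * p%:~R) (2 * pi / 3 * q%:~R) (- (pi / 2) : R).
  apply: eq_integrable; first exact: measurable_Delta.
  by move=> t _ /=; rewrite cosBpihalf.
- rewrite /cintegral /intDelta_cos; congr (_ +i* _); apply: eq_Rintegral => t _ /=.
    by rewrite addr0.
  by rewrite cosBpihalf.
Qed.

Lemma TC_cintegral m (k : 'rV[int]_3) : k \in Lambda m ->
  is_cintegral mu2 (@Delta R) (fun t => in_coords (TC k) t.1 t.2) ((k == 0)%:R / 2).
Proof.
move=> kL.
pose a := k 0 0 - k 0 2; pose b := k 0 1 - k 0 2.
pose W (pq : int * int) : R[i] :=
  (intDelta_cos (2 * pi / 3 * pq.1%:~R) (2 * pi / 3 * pq.2%:~R) 0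
     +i* intDelta_cos (2 * pi / 3 * pq.1%:~R) (2 * pi / 3 * pq.2%:~R) (- (pi / 2))).
have -> : (k == 0)%:R / 2 = 6^-1 * \sum_(pq <- orbit6 a b) W pq.
  have [k0|k0] := eqVneq k 0.
    rewrite /a /b k0 !mxE !big_cons big_nil/= /W/= !subrr !oppr0 !mulr0 !intDelta_cos0.
    rewrite cos0 cosN cos_pihalf mulr1 mulr0 (_ : _ +i* 0 = 2^-1) ?addr0.
      by field.
    by rewrite -[2 in RHS](rmorph_nat (real_complex R)) -fmorphV.
  have [a0 b0 bE ab] := Lambda_frequencies kL k0.
  rewrite mul0r (_ : \sum_(_ <- _) _ = 0) ?mulr0//.
  have al3 : 2 * pi / 3 *+ 3 = pi *+ 2 :> R.
    by rewrite -[LHS]mulr_natr -[RHS]mulr_natr; field.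
  have Q0 : a ^+ 2 - a * b + b ^+ 2 != 0 by rewrite gt_eqF//; nia.
  by rewrite sum_complex !(intDelta_cos_orbit6 _ al3 bE Q0).
have isW pq : pq \in orbit6 a b ->
    is_cintegral mu2 (@Delta R) (fun t => wave pq.1 pq.2 t.1 t.2) (W pq).
  by move=> _; exact: wave_cintegral.
have := is_cintegralZ (@measurable_Delta R) (6^-1)
  (is_cintegral_sum (@measurable_Delta R) isW).
by apply: is_cintegral_eq => [|t _]; rewrite /in_coords ?TC_orbit6//; exact: measurable_Delta.
Qed.

Definition cubature n (g : R -> R -> R[i]) : R[i] :=
  (3 * n%:R ^+ 2)^-1 *
    \sum_(0 <= j1 < n.+1) \sum_(0 <= j2 < (n - j1).+1)
      (lambda n (vec3 j1%:Z j2%:Z (- j1%:Z - j2%:Z)))%:R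
      * g (j1%:R / n%:R) (j2%:R / n%:R).

Lemma cubature_wave n (p q : int) : (0 < n)%N ->
  cubature n (wave p q) = (3 * n%:R ^+ 2)^-1 *
    weighted_sum n (cis (2 * pi / 3 * p%:~R / n%:R)) (cis (2 * pi / 3 * q%:~R / n%:R)).
Proof.
move=> n0; rewrite /cubature -sum_lambda_powers//; congr (_ * _).
apply: eq_bigr => i _; apply: eq_bigr => j _; congr (_ * _).
rewrite /wave cisD -!cisMn -[_ *+ i]mulr_natr -[_ *+ j]mulr_natr.
by congr (cis _ * cis _); ring.
Qed.

Lemma cubature_sum n (I : Type) (s : seq I) (c : I -> R[i]) (g : I -> R -> R -> R[i]) :
  cubature n (fun x y => \sum_(i <- s) c i * g i x y) =
  \sum_(i <- s) c i * cubature n (g i).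
Proof.
rewrite /cubature.
under [RHS]eq_bigr do rewrite mulrCA.
rewrite -big_distrr/=; congr (_ * _).
under [RHS]eq_bigr do rewrite big_distrr/=.
rewrite [RHS]exchange_big/=; apply: eq_bigr => j1 _.
under [RHS]eq_bigr do rewrite big_distrr/=.
rewrite [RHS]exchange_big/=; apply: eq_bigr => j2 _.
by rewrite big_distrr/=; apply: eq_bigr => i _; rewrite mulrCA.
Qed.

Lemma cubature_TC n (k : 'rV[int]_3) : (0 < n)%N -> k \in Lambda (2 * n - 1) ->
  cubature n (in_coords (TC k)) = (k == 0)%:R.
Proof.
move=> n0 kL.
have n0' : n%:R != 0 :> R by rewrite pnatr_eq0 -lt0n.
have n0C : n%:R != 0 :> R[i] by rewrite pnatr_eq0 -lt0n.
pose a := k 0 0 - k 0 2; pose b := k 0 1 - k 0 2.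
pose z (p : int) := cis (2 * pi / 3 * p%:~R / n%:R : R).
have -> : cubature n (in_coords (TC k)) =
   6^-1 * ((3 * n%:R ^+ 2)^-1 * \sum_(pq <- orbit6 a b) weighted_sum n (z pq.1) (z pq.2)).
  transitivity (cubature n (fun x y => \sum_(pq <- orbit6 a b) 6^-1 * wave pq.1 pq.2 x y)).
    congr cubature; apply/funext => x; apply/funext => y.
    by rewrite /in_coords TC_orbit6 big_distrr.
  rewrite cubature_sum -big_distrr/=; congr (_ * _).
  by rewrite [RHS]big_distrr/=; apply: eq_bigr => pq _; rewrite cubature_wave.
have [k0|k0] := eqVneq k 0.
  have z0 : z 0 = 1 by rewrite /z mulr0 mul0r cis0.
  rewrite /a /b k0 !mxE !big_cons big_nil/= !subrr !oppr0 !z0 weighted_sum11.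
  by field.
have [a0 b0 bE ab] := Lambda_frequencies kL k0.
rewrite -/a -/b in a0 b0 bE ab.
rewrite (_ : \sum_(_ <- _) _ = 0) ?mulr0//.
have zB p q : z (p - q) = z p / z q.
  by rewrite /z -cisN -cisD; congr cis; rewrite rmorphB/=; ring.
have zN p : z (- p) = (z p)^-1.
  by rewrite /z -cisN; congr cis; rewrite rmorphN/=; ring.
have zn p : z p ^+ n = cis (2 * pi / 3 * p%:~R).
  by rewrite -cisMn -[_ *+ n]mulr_natr divfK.
have al3 (m : int) : 2 * pi / 3 * (3 * m)%:~R = pi *+ 2 *~ m :> R.
  by rewrite -mulrzr -[pi *+ 2]mulr_natr; field.
have wave3 : (z a ^+ n) ^+ 3 = 1.
  by rewrite zn -cisMn -[RHS](cis_2piz R a) -al3 -[_ *+ 3]mulr_natr; congr cis; ring.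
have zb : z b ^+ n = (z a ^+ n) ^+ 2.
  rewrite bE zB exprMn exprVn !zn al3 cis_2piz mul1r.
  apply: (mulfI (cis_neq0 (2 * pi / 3 * a%:~R))).
  by rewrite divff ?cis_neq0// -exprS -zn.
have L0 : lattice_laplacian (z a) (z b) != 0.
  have bnd (p : int) : 0 < p < 3 * n%:Z ->
      0 < (2 * pi / 3 * p%:~R / n%:R : R) < pi *+ 2.
    move=> /andP[p0 pn].
    have n_gt0 : 0 < n%:R :> R by rewrite ltr0n.
    have p_gt0 : 0 < p%:~R :> R by rewrite ltr0z.
    have p_lt : p%:~R < 3 * n%:R :> R.
      by rewrite -[ltRHS](rmorphM (intmul 1) 3 n%:Z) ltr_int.
    have tau_gt0 : 0 < (pi : R) *+ 2 by rewrite pmulrn_lgt0// pi_gt0.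
    have -> : 2 * pi / 3 * p%:~R / n%:R = (pi *+ 2) * (p%:~R / (3 * n%:R)) :> R.
      by rewrite -[pi *+ 2]mulr_natr; field.
    have n3_gt0 : 0 < 3 * n%:R :> R by rewrite mulr_gt0.
    by rewrite mulr_gt0 ?divr_gt0//= gtr_pMr// ltr_pdivrMr// mul1r.
  apply: lattice_laplacian_cis_neq0.
  (* a + b < 6 n, so a and b cannot both be at least 3 n. *)
  have [/bnd ->//|an] := boolP (0 < a < 3 * n%:Z).
  by rewrite (bnd b) ?orbT//; lia.
have z_neq0 p : z p != 0 by exact: cis_neq0.
(* Were a and b transparent, zB would also rewrite z a and z b themselves. *)
clearbody a b z.
apply: (mulfI L0); rewrite mulr0 !big_cons big_nil/= addr0 !zB !zN.
by have := laplacian_orbit_sum (z_neq0 a) (z_neq0 b) erefl zb wave3; rewrite !addrA.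
Qed.

End Exactness.

Theorem theorem4p5 (R : realType) (n : nat) (hn : (1 <= n)%N)
    (f : 'rV[R]_3 -> R[i]) (hf : TCspan (2 * n - 1)%N f) :
  2 * cintegral (lebesgue_measure \x lebesgue_measure)%E (@Delta R)
        (fun t => in_coords f t.1 t.2)
  = (3 * n%:R ^+ 2)^-1 *
    \sum_(0 <= j1 < n.+1) \sum_(0 <= j2 < (n - j1).+1)
      (lambda n (vec3 j1%:Z j2%:Z (- j1%:Z - j2%:Z)))%:R
      * in_coords f (j1%:R / n%:R) (j2%:R / n%:R).
Proof.
have [s [c [sL fE]]] := hf.
have fE' x y : in_coords f x y = \sum_(k <- s) c k * in_coords (TC k) x y.
  by rewrite /in_coords fE// inE !vec3E; apply/eqP; ring.
rewrite -[RHS]/(cubature n (in_coords f)).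
have -> : in_coords f = fun x y => \sum_(k <- s) c k * in_coords (TC k) x y.
  by apply/funext => x; apply/funext => y.
rewrite cubature_sum.
have I k : k \in s -> is_cintegral (lebesgue_measure \x lebesgue_measure)%E (@Delta R)
    (fun t => c k * in_coords (TC k) t.1 t.2) (c k * ((k == 0)%:R / 2)).
  move=> ks; apply: is_cintegralZ; first exact: measurable_Delta.
  exact: TC_cintegral (sL _ ks).
have [_ _ ->] := is_cintegral_sum (@measurable_Delta R) I.
rewrite big_distrr/=; apply: eq_big_seq => k ks.
by rewrite cubature_TC ?sL//; field.
Qed.
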